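(* Let $(x^k,v^k,\xi^k)_{k\ge 0}$ be generated by the LLM-SOF algorithm (described in the context) with time step $\Delta t>0$ and damping coefficients $\eta^k>0$. Then the Lagrange multiplier satisfies $\xi^k>0$ for all $k\ge 0$. Furthermore, the algorithm is unconditionally energy stable in the sense that, for every $k\ge 0$, $$\tilde{\mathcal E}^{k+1}-\tilde{\mathcal E}^{k}=-\Delta t\,\eta^{k+1}\|v^{k+1}\|^2\le 0,$$ where the modified pseudo-energy $\tilde{\mathcal E}^{k+1}:=\xi^{k+1}\mathcal E(x^k,v^k)$ is nonnegative for all $k\ge 0$.
   Context: $\mathbb R^N$ carries the standard inner product and norm $\|\cdot\|$. The function $f:\mathbb R^N\to\mathbb R$ is differentiable and has a minimizer. The pseudo-energy is $\mathcal E(x,v):=f(x)+\frac12\|v\|^2$. Standing assumption: $\mathcal E(x,v)>0$ for all $x,v$ (equivalently $f>0$ everywhere). $\mathcal L$ is a linear positive semidefinite operator on $\mathbb R^N$, $S>0$ is a constant, and $I$ is the identity. LLM-SOF algorithm. Inputs: $x^0,v^0\in\mathbb R^N$, $\Delta t>0$, $\xi^0=1$, $\eta^k>0$ for all $k\ge1$. Set $x^{-1}=x^0$, $v^{-1}=v^0$, and write $\mathcal E^k:=\mathcal E(x^k,v^k)$ for $k\ge -1$. For $k=0,1,2,\dots$: (1) $z^{k+1}=\left(\frac{I}{\Delta t}+S\Delta t\,\mathcal L+\eta^{k+1}I\right)^{-1}\left(\frac{v^k}{\Delta t\,\xi^k}-\nabla f(x^k)\right)$; (2) if $\|z^{k+1}\|\ne0$,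 $\xi^{k+1}=\dfrac{-\frac{\mathcal E^k}{\Delta t}+\sqrt{\left(\frac{\mathcal E^k}{\Delta t}\right)^2+4\eta^{k+1}\|z^{k+1}\|^2\frac{\xi^k\mathcal E^{k-1}}{\Delta t}}}{2\eta^{k+1}\|z^{k+1}\|^2}$; otherwise $\xi^{k+1}=\dfrac{\xi^k\mathcal E^{k-1}}{\mathcal E^k}$; (3) $v^{k+1}=\xi^{k+1}z^{k+1}$ and $x^{k+1}=x^k+\Delta t\,\xi^{k+1}z^{k+1}$. The modified pseudo-energy is $\tilde{\mathcal E}^{k+1}:=\xi^{k+1}\mathcal E^k$ for $k\ge -1$; in particular $\tilde{\mathcal E}^0=\xi^0\mathcal E^{-1}=\mathcal E(x^0,v^0)$. *)

(* Defs.v *)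
From HB Require Import structures.
From mathcomp Require Import all_boot all_order all_algebra.
From mathcomp Require Import all_classical all_reals all_analysis.

Set Implicit Arguments.
Unset Strict Implicit.
Unset Printing Implicit Defensive.

Import Order.TTheory GRing.Theory Num.Theory.
Import numFieldNormedType.Exports.

Local Open Scope ring_scope.

Definition dotp (R : realType) (N : nat) (u w : 'cV[R]_N) : R :=
  \sum_(i < N) u i 0 * w i 0.

(* The library norm `|u| on 'cV[R]_N is the sup norm; it is only used (through
   the topology, which is the same) for differentiability. *)
Definition enorm (R : realType) (N : nat) (u : 'cV[R]_N) : R :=
  Num.sqrt (dotp u u).

Definition grad (R : realType) (N : nat) (f : 'cV[R]_N -> R) (x : 'cV[R]_N) :
    'cV[R]_N :=
  \col_(i < N) ('D_(delta_mx i 0) f x).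

(* No symmetry of L is assumed. *)
Definition psd (R : realType) (N : nat) (L : 'M[R]_N) : Prop :=
  forall u : 'cV[R]_N, 0 <= dotp u (L *m u).

Definition pseudo_energy (R : realType) (N : nat) (f : 'cV[R]_N -> R)
    (x v : 'cV[R]_N) : R :=
  f x + 2^-1 * enorm v ^+ 2.

(* E^k along the iterates.  Since 0.-1 = 0, the convention x^{-1} = x^0,
   v^{-1} = v^0 makes E^{k-1} equal to [energy_at f x v k.-1] for all k >= 0. *)
Definition energy_at (R : realType) (N : nat) (f : 'cV[R]_N -> R)
    (x v : nat -> 'cV[R]_N) (k : nat) : R :=
  pseudo_energy f (x k) (v k).

(* xi^k E^{k-1}, for k >= 0. *)
Definition modified_energy (R : realType) (N : nat) (f : 'cV[R]_N -> R)
    (x v : nat -> 'cV[R]_N) (xi : nat -> R) (k : nat) : R :=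
  xi k * energy_at f x v k.-1.

(* z^{k+1} from (x^k, v^k, xi^k) and eta = eta^{k+1}.  The matrix is invertible
   whenever dt, S, eta > 0 and L is positive semidefinite. *)
Definition z_step (R : realType) (N : nat) (f : 'cV[R]_N -> R) (L : 'M[R]_N)
    (S dt eta : R) (x v : 'cV[R]_N) (xi : R) : 'cV[R]_N :=
  invmx (dt^-1%:M + (S * dt) *: L + eta%:M) *m ((dt * xi)^-1 *: v - grad f x).

(* xi^{k+1}, with eta = eta^{k+1}, E = E^k, Eprev = E^{k-1}, xi = xi^k and
   z = z^{k+1}. *)
Definition xi_step (R : realType) (N : nat) (dt eta E Eprev xi : R)
    (z : 'cV[R]_N) : R :=
  if enorm z != 0 then
    (- (E / dt) +
       Num.sqrt ((E / dt) ^+ 2 + 4 * eta * enorm z ^+ 2 * (xi * Eprev / dt)))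
    / (2 * eta * enorm z ^+ 2)
  else xi * Eprev / E.

(* z 0 and eta 0 are never used; x 0 and v 0 are the inputs. *)
Definition llm_sof (R : realType) (N : nat) (f : 'cV[R]_N -> R) (L : 'M[R]_N)
    (S dt : R) (eta : nat -> R)
    (x v z : nat -> 'cV[R]_N) (xi : nat -> R) : Prop :=
  xi 0%N = 1 /\
  forall k : nat,
    [/\ z k.+1 = z_step f L S dt (eta k.+1) (x k) (v k) (xi k),
        xi k.+1 = xi_step dt (eta k.+1) (energy_at f x v k)
                    (energy_at f x v k.-1) (xi k) (z k.+1),
        v k.+1 = xi k.+1 *: z k.+1
      & x k.+1 = x k + (dt * xi k.+1) *: z k.+1].

(* Main.v *)
Require Import Defs.
From mathcomp Require Import all_boot all_order all_algebra.
From mathcomp Require Import all_classical all_reals all_analysis.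
From mathcomp Require Import ring lra.

Import Order.TTheory GRing.Theory Num.Theory.
Import numFieldNormedType.Exports.

Local Open Scope ring_scope.

(** The update formula for [xi k.+1] is the root
      t = (- b + sqrt (b ^ 2 + 4 a c)) / (2 a)
    of the quadratic equation a t ^ 2 + b t = c, where
      a = eta^{k+1} |z^{k+1}| ^ 2,  b = E^k / dt,  c = xi^k E^{k-1} / dt.
    Since a and c are positive, the two roots have negative product - c / a,
    and the one with the plus sign is the positive one ([pos_quadratic_root]).
    Multiplied by dt, and with v^{k+1} = xi^{k+1} z^{k+1}, the equation reads
      dt eta^{k+1} |v^{k+1}| ^ 2 + xi^{k+1} E^k = xi^k E^{k-1},
    which is exactly the energy law.  When z^{k+1} = 0 the equation degenerates
    to the linear one b t = c, and the second branch of the update is its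
    solution; [xi_step_spec] covers both cases.  Positivity of the multipliers
    then propagates by induction, because c stays positive as long as xi^k and
    the energies are.  No step of this argument restricts the size of dt, so the
    stability is unconditional. *)

Lemma enormZ_sqr (R : realType) (N : nat) (a : R) (u : 'cV[R]_N) :
  enorm (a *: u) ^+ 2 = a ^+ 2 * enorm u ^+ 2.
Proof.
have dotp_ge0 (w : 'cV[R]_N) : 0 <= dotp w w.
  by apply: sumr_ge0 => i _; rewrite -expr2 sqr_ge0.
rewrite /enorm !sqr_sqrtr // /dotp mulr_sumr.
by apply: eq_bigr => i _; rewrite !mxE; ring.
Qed.

(** The discriminant exceeds b ^ 2, so its square root exceeds b in absolute
    value; hence the sign of b does not affect the positivity of this root. *)
Lemma pos_quadratic_root (R : rcfType) (a b c : R) (a_gt0 : 0 < a)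
    (c_gt0 : 0 < c) (t := (- b + Num.sqrt (b ^+ 2 + 4 * a * c)) / (2 * a)) :
  0 < t /\ a * t ^+ 2 + b * t = c.
Proof.
have ac_gt0 : 0 < a * c by rewrite mulr_gt0.
have sqr_disc : Num.sqrt (b ^+ 2 + 4 * a * c) ^+ 2 = b ^+ 2 + 4 * a * c.
  by apply: sqr_sqrtr; have := sqr_ge0 b; lra.
have b_lt : b < Num.sqrt (b ^+ 2 + 4 * a * c).
  apply: le_lt_trans (ler_norm b) _; rewrite -sqrtr_sqr.
  by rewrite ltr_sqrt; have := sqr_ge0 b; lra.
split; first by rewrite /t divr_gt0 //; lra.
rewrite /t; move: (Num.sqrt _) sqr_disc => s s2.
have -> : a * ((- b + s) / (2 * a)) ^+ 2 + b * ((- b + s) / (2 * a))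
    = (s ^+ 2 - b ^+ 2) / (4 * a) by field; rewrite gt_eqF.
by rewrite s2; field; rewrite gt_eqF.
Qed.

(** Clearing the denominator dt in the quadratic equation turns it into an
    energy balance, in which the quadratic term is the energy dissipated by the
    damping over the step. *)
Lemma xi_step_spec (R : realType) (N : nat) (dt eta E Eprev xi : R)
    (z : 'cV[R]_N) (dt_gt0 : 0 < dt) (eta_gt0 : 0 < eta) (E_gt0 : 0 < E)
    (Eprev_gt0 : 0 < Eprev) (xi_gt0 : 0 < xi)
    (t := xi_step dt eta E Eprev xi z) :
  0 < t /\ dt * eta * enorm (t *: z) ^+ 2 + t * E = xi * Eprev.
Proof.
rewrite enormZ_sqr /t /xi_step; case: eqVneq => [z0 | z_neq0] /=.
  split; first by rewrite divr_gt0 ?mulr_gt0.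
  by rewrite z0; field; rewrite gt_eqF.
have a_gt0 : 0 < eta * enorm z ^+ 2.
  by rewrite mulr_gt0 // exprn_gt0 // lt_def z_neq0 sqrtr_ge0.
have c_gt0 : 0 < xi * Eprev / dt by rewrite divr_gt0 ?mulr_gt0.
have := pos_quadratic_root _ _ (E / dt) _ a_gt0 c_gt0.
rewrite /= !(mulrA _ eta); set s := _ / (2 * eta * _) => -[s_gt0 s_root].
split=> //.
have -> : dt * eta * (s ^+ 2 * enorm z ^+ 2) + s * E
    = dt * (eta * enorm z ^+ 2 * s ^+ 2 + E / dt * s).
  by field; rewrite gt_eqF.
rewrite [X in dt * X]s_root.
by field; rewrite gt_eqF.
Qed.

Theorem theorem2p1 (R : realType) (N : nat) (f : 'cV[R]_N -> R)
    (L : 'M[R]_N) (S dt : R) (eta : nat -> R)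
    (x v z : nat -> 'cV[R]_N) (xi : nat -> R)
    (f_diff : forall y : 'cV[R]_N, differentiable f y)
    (f_min : exists xmin : 'cV[R]_N, forall y : 'cV[R]_N, f xmin <= f y)
    (energy_gt0 : forall y w : 'cV[R]_N, 0 < pseudo_energy f y w)
    (L_psd : psd L)
    (S_gt0 : 0 < S)
    (dt_gt0 : 0 < dt)
    (eta_gt0 : forall k : nat, (1 <= k)%N -> 0 < eta k)
    (alg : llm_sof f L S dt eta x v z xi) :
  (forall k : nat, 0 < xi k) /\
  (forall k : nat,
     modified_energy f x v xi k.+1 - modified_energy f x v xi k
       = - (dt * eta k.+1 * enorm (v k.+1) ^+ 2) /\
     - (dt * eta k.+1 * enorm (v k.+1) ^+ 2) <= 0) /\
  (forall k : nat, 0 <= modified_energy f x v xi k.+1).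
Proof.
case: alg => xi0 step.
have E_gt0 k : 0 < energy_at f x v k by exact: energy_gt0.
have balance k : 0 < xi k -> 0 < xi k.+1 /\
    dt * eta k.+1 * enorm (v k.+1) ^+ 2 + modified_energy f x v xi k.+1
      = modified_energy f x v xi k.
  move=> xik_gt0; have [_ xiE vE _] := step k.
  rewrite vE /modified_energy /= xiE.
  by apply: xi_step_spec => //; exact: eta_gt0.
have xi_gt0 k : 0 < xi k.
  by elim: k => [|k /balance[]//]; rewrite xi0.
split=> //; split=> k; last by rewrite mulr_ge0 // ltW.
split; first by have [_ <-] := balance k (xi_gt0 k); ring.
by rewrite oppr_le0 mulr_ge0 ?sqr_ge0 // ltW // mulr_gt0 // eta_gt0.
Qed.
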